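(* Let $N\ge2$, $0<\alpha<1$, and let $f\in L^1_1(\mathbb{R}^N)$ be a nonnegative smooth solution of $$\Delta_v f+Q(f,f)=0,\qquad v\in\mathbb{R}^N,$$ with mass $\rho_0=\int_{\mathbb{R}^N}f\,dv>0$. Let $r>0$ and let $a>0$ be a constant such that, for $h(v)=e^{-a|v|^{3/2}}$, $$\Delta h(v)-(f*|\cdot|)(v)\,h(v)\ge0\quad\text{for all }|v|>r.$$ Then there is a constant $K>0$ such that $$f(v)\ge K e^{-2a|v|^{3/2}}\quad\text{for all }v\in\mathbb{R}^N.$$
   Context: $L^1_1(\mathbb{R}^N)=\{f:\ f(1+|v|^2)^{1/2}\in L^1(\mathbb{R}^N)\}$, and $(f*|\cdot|)(v)=\int f(v_* )|v-v_*|\,dv_*$. For each $r>0$ constants $a>0$ with the required property exist. Inelastic hard sphere collision operator: fix the restitution coefficient $0<\alpha<1$ and $\beta=\frac{1+\alpha}{2}$. For $v,v_*\in\mathbb{R}^N$ and $\sigma\in S^{N-1}$ put $u=v-v_*$, $\nu=u/|u|$, $u'=(1-\beta)u+\beta|u|\sigma$, $v'=\frac{v+v_*}{2}+\frac{u'}{2}$, $v'_*=\frac{v+v_*}{2}-\frac{u'}{2}$. The kernel is $b(u,\sigma)=c_N\left(\frac{1-\nu\cdot\sigma}{2}\right)^{-\frac{N-3}{2}}$ with $c_N>0$ chosen so that $\int_{S^{N-1}}b(u,\sigma)\,d\sigma=1$. With $f_*=f(v_* )$, $\psi'=\psi(v')$, etc., $Q(f,f)$ is defined by $$\int_{\mathbb{R}^N}Q(f,f)\psi\,dv=\frac12\int\int\int_{S^{N-1}}f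 f_*(\psi'+\psi'_*-\psi-\psi_* )|u|\,b(u,\sigma)\,d\sigma\,dv\,dv_*.$$ Equivalently $Q=Q^+-Q^-$ with $Q^-(f,f)=f\,(f*|\cdot|)$ and $Q^+(f,f)(v)=\int\int f('v)f('v_* )\frac{1}{\alpha^2}|u|b(u,\sigma)\,d\sigma\,dv_*$, where $'v=\frac{v+v_*}{2}+\frac{'u}{2}$, $'v_*=\frac{v+v_*}{2}-\frac{'u}{2}$, $'u=(1-\gamma)u+\gamma|u|\sigma$, $\gamma=\frac{1+\alpha}{2\alpha}$. *)

(* Defs.v *)
From HB Require Import structures.
From mathcomp Require Import all_boot all_order all_algebra.
From mathcomp Require Import all_classical all_reals all_analysis.
From mathcomp Require Import measurable_realfun.

Set Implicit Arguments.
Unset Strict Implicit.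
Unset Printing Implicit Defensive.

Import Order.TTheory GRing.Theory Num.Theory.
Import numFieldNormedType.Exports.

Local Open Scope classical_set_scope.
Local Open Scope ring_scope.

(* R^n is 'rV[R]_n. Its library norm `|v| is the sup norm (used only for the
   topology), hence the separate Euclidean norm. *)
Definition dot (R : realType) (n : nat) (u v : 'rV[R]_n) : R :=
  \sum_(i < n) u 0 i * v 0 i.

Definition enorm (R : realType) (n : nat) (v : 'rV[R]_n) : R :=
  Num.sqrt (dot v v).

(* Equal to 0 at v = 0. *)
Definition edir (R : realType) (n : nat) (v : 'rV[R]_n) : 'rV[R]_n :=
  (enorm v)^-1 *: v.

(* Borel sigma-algebra of R^n, generated by the coordinates, as for the
   library's n.-tuple. *)
Definition measure_rV_display : measure_display.
Proof. exact: default_measure_display. Qed.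

Section measurable_rV.
Context (R : realType) (n : nat).

Let coors : 'I_n -> 'rV[R]_n -> R := fun i v => v 0 i.

Let rV_set0 : g_sigma_preimage coors set0.
Proof. exact: sigma_algebra0. Qed.

Let rV_setC A : g_sigma_preimage coors A -> g_sigma_preimage coors (~` A).
Proof. exact: sigma_algebraC. Qed.

Let rV_bigcup (F : (set 'rV[R]_n)^nat) :
  (forall i, g_sigma_preimage coors (F i)) ->
  g_sigma_preimage coors (\bigcup_i (F i)).
Proof. exact: sigma_algebra_bigcup. Qed.

HB.instance Definition _ := @isMeasurable.Build measure_rV_display 'rV[R]_n
  (g_sigma_preimage coors) rV_set0 rV_setC rV_bigcup.

Lemma measurable_coord (i : 'I_n) :
  measurable_fun [set: 'rV[R]_n] (fun v : 'rV[R]_n => v 0 i).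
Proof.
move=> _ Y mY; rewrite setTI; apply: sub_sigma_algebra => /=.
rewrite -bigcup_seq/=; exists i => /=; first by rewrite mem_index_enum.
by exists Y => //; rewrite setTI.
Qed.

Lemma measurable_fun_rV d (T : measurableType d) (f : T -> 'rV[R]_n) :
  (forall i, measurable_fun [set: T] (fun x => f x 0 i)) ->
  measurable_fun [set: T] f.
Proof.
move=> mf _ Y; rewrite setTI.
pose G := [set B : set 'rV[R]_n | measurable (f @^-1` B)].
suff sub : g_sigma_preimage coors `<=` G by move=> mY; exact: sub.
apply: smallest_sub.
  split; rewrite /G /=.
  - by rewrite preimage_set0.
  - by move=> A GA; rewrite setTD preimage_setC; exact: measurableC.
  - by move=> F GF; rewrite preimage_bigcup; apply: bigcup_measurable.
rewrite -bigcup_seq => B [i _ [A mA <-]]; rewrite /G /= setTI.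
by rewrite -[X in measurable X]setTI; exact: (mf i measurableT A mA).
Qed.

End measurable_rV.

Section image_measure.
Context d d' (T : measurableType d) (U : measurableType d') (R : realType).

Definition image_measure (m : {measure set T -> \bar R}) (f : T -> U)
  (mf : measurable_fun setT f) : {measure set U -> \bar R} :=
  measure_function_pushforward__canonical__measure_function_Measure m mf.

Lemma image_measureE m f mf A : @image_measure m f mf A = m (f @^-1` A).
Proof. by []. Qed.

End image_measure.

Section lebesgue_rV.
Variable R : realType.

Definition rV_cons (n : nat) (p : 'rV[R]_n * measurableTypeR R) : 'rV[R]_n.+1 :=
  row_mx (const_mx p.2 : 'rV[R]_1) p.1.

Lemma measurable_rV_cons (n : nat) : measurable_fun setT (@rV_cons n).
Proof.
apply: measurable_fun_rV => i.
have [j|j] := @split_ordP 1 n i.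
  move=> ->; rewrite (_ : (fun _ => _) = snd) //.
  by apply/funext => p; apply: etrans (row_mxEl _ _ _ _) _; rewrite mxE.
move=> ->; rewrite (_ : (fun _ => _) = (fun v : 'rV[R]_n => v 0 j) \o fst).
  by apply: measurableT_comp; [exact: measurable_coord|exact: measurable_fst].
by apply/funext => p; exact: row_mxEr.
Qed.

(* The n-fold product of the one-dimensional Lebesgue measure. *)
Fixpoint lebesgue_rV (n : nat) : {measure set 'rV[R]_n -> \bar R} :=
  match n with
  | 0 => dirac (0 : 'rV[R]_0)
  | n'.+1 =>
      image_measure (lebesgue_rV n' \x lebesgue_measure)%E
        (@measurable_rV_cons n')
  end.

End lebesgue_rV.

Section sphere_measure.
Variables (R : realType) (n : nat).
Implicit Types (u v : 'rV[R]_n).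

Lemma measurable_enorm : measurable_fun setT (@enorm R n).
Proof.
have ms : measurable_fun setT (@Num.sqrt R).
  by apply: continuous_measurable_fun; exact: sqrt_continuous.
apply: (measurableT_comp ms).
rewrite (_ : (fun _ => _) = fun v => \sum_(i < n) v 0 i * v 0 i) //.
apply: measurable_sum => i.
by apply: measurable_funM; exact: measurable_coord.
Qed.

Lemma measurable_edir : measurable_fun setT (@edir R n).
Proof.
apply: measurable_fun_rV => i.
rewrite (_ : (fun _ => _) = fun v => enorm v `^ (- 1) * v 0 i); last first.
  by apply/funext => v; rewrite /edir mxE powR_inv1 ?sqrtr_ge0.
apply: measurable_funM; last exact: measurable_coord.
by apply: (measurableT_comp (f := @powR R ^~ (- 1)))=> //; exact: measurable_enorm.
Qed.

Definition punctured_ball : set 'rV[R]_n := [set v | 0 < enorm v <= 1].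

Lemma measurable_punctured_ball : measurable punctured_ball.
Proof.
rewrite (_ : punctured_ball = setT `&` (@enorm R n) @^-1` `]0, 1]).
  by apply: measurable_enorm => //; exact: measurable_itv.
by rewrite setTI; apply/seteqP; split => v /=; rewrite in_itv.
Qed.

(* Surface measure of the unit sphere S^(n-1), as a measure on R^n carried by
   the sphere: sigma(A) = n * |{x : 0 < |x| <= 1, x/|x| \in A}|, i.e. the measure
   dsigma of the polar decomposition dx = r^(n-1) dr dsigma. *)
Definition sphere_measure : {measure set 'rV[R]_n -> \bar R} :=
  mscale (n%:R%:nng : {nonneg R})
    (image_measure (mrestr (lebesgue_rV R n) measurable_punctured_ball)
      measurable_edir).

End sphere_measure.

Section calculus.
Variables (R : realType) (n : nat).
Implicit Types (f : 'rV[R]_n -> R) (v : 'rV[R]_n).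

Definition basis_vec (i : 'I_n) : 'rV[R]_n := delta_mx 0 i.

Definition partial (i : 'I_n) f : 'rV[R]_n -> R :=
  fun v => 'D_(basis_vec i) f v.

(* With the library's total derivative; meaningful where f is twice
   differentiable. *)
Definition laplacian f v : R := \sum_(i < n) partial i (partial i f) v.

Fixpoint class_C (k : nat) f : Prop :=
  match k with
  | 0 => continuous f
  | k'.+1 => continuous f /\ forall i : 'I_n,
      (forall v, derivable f v (basis_vec i)) /\ class_C k' (partial i f)
  end.

Definition smooth f : Prop := forall k, class_C k f.

(* f in L^1_1(R^n). *)
Definition L11 f : Prop :=
  (lebesgue_rV R n).-integrable setT
    (fun v => (f v * Num.sqrt (1 + enorm v ^+ 2))%:E).

(* f * |.| ; the integrand is integrable when f is in L^1_1. *)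
Definition conv_norm f v : R :=
  \int[lebesgue_rV R n]_w (f w * enorm (v - w)).

Definition test_fun (psi : 'rV[R]_n -> R) : Prop :=
  continuous psi /\ compact (closure [set v | psi v != 0]).

End calculus.

Section collision.
Variables (R : realType) (n : nat) (alpha c : R).
Implicit Types (f Q psi : 'rV[R]_n -> R) (u v w s : 'rV[R]_n).

(* At s = nu and n > 3 the library convention 0 `^ p = 0 for p != 0 replaces
   +oo; this is a sphere_measure-null set of s. *)
Definition kernel_b u s : R :=
  c * ((1 - dot (edir u) s) / 2) `^ (- ((n%:R - 3) / 2)).

Definition kernel_normalized : Prop :=
  0 < c /\ forall u, u != 0 ->
    (\int[sphere_measure R n]_s (kernel_b u s)%:E = 1)%E.

Definition post_u u s : 'rV[R]_n :=
  let beta := (1 + alpha) / 2 in (1 - beta) *: u + (beta * enorm u) *: s.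

Definition post_v v w s : 'rV[R]_n :=
  2^-1 *: (v + w) + 2^-1 *: post_u (v - w) s.

Definition post_w v w s : 'rV[R]_n :=
  2^-1 *: (v + w) - 2^-1 *: post_u (v - w) s.

Definition collision_weak f psi : \bar R :=
  ((2^-1)%:E *
   \int[lebesgue_rV R n]_w \int[lebesgue_rV R n]_v \int[sphere_measure R n]_s
     (f v * f w *
      (psi (post_v v w s) + psi (post_w v w s) - psi v - psi w) *
      enorm (v - w) * kernel_b (v - w) s)%:E)%E.

(* The weak form determines Q(f,f) up to a null set; Q is any function in that
   class. *)
Definition is_collision f Q : Prop :=
  forall psi, test_fun psi ->
    (lebesgue_rV R n).-integrable setT (fun v => (Q v * psi v)%:E) /\
    (\int[lebesgue_rV R n]_v (Q v * psi v)%:E = collision_weak f psi)%E.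

End collision.

Arguments kernel_normalized {R} n c.

(* Main.v *)
Require Import Defs.
From mathcomp Require Import all_boot all_order all_algebra.
From mathcomp Require Import all_classical all_reals all_analysis.
From mathcomp Require Import measurable_realfun ring lra.

Set Implicit Arguments.
Unset Strict Implicit.
Unset Printing Implicit Defensive.

Import Order.TTheory GRing.Theory Num.Theory.
Import numFieldNormedType.Exports.
Local Open Scope classical_set_scope.
Local Open Scope ring_scope.

(* Discarding the gain term, [f] is a supersolution: with [g = f * |.|] one has
   [lap f <= g f]. Pointwise this comes from testing the weak form of [Q] against
   nonnegative bumps concentrating at a point.

   By comparison with the barrier [exp(-l |v-x|^2) - exp(-l R^2)] on an annulus
   centred at a point [x] where [f x > 0], [f] is bounded below by a positive
   constant on every ball. In particular [f >= K > 0] on [|v| <= r] and [g > 0]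
   everywhere.

   Since [lap h >= g h] for [|v| > r], the maximum principle on the exterior of the
   ball gives [f >= K h] there; as [h >= h^2], this is stronger than the claim. *)

(** * Euclidean norm *)

Section euclidean_norm.
Context {R : realType} {n : nat}.
Implicit Types (u v w : 'rV[R]_n) (t : R).

Lemma dotC u v : dot u v = dot v u.
Proof. by apply: eq_bigr => i _; rewrite mulrC. Qed.

Lemma dotDl u v w : dot (u + v) w = dot u w + dot v w.
Proof. by rewrite -big_split; apply: eq_bigr => i _; rewrite mxE mulrDl. Qed.

Lemma dotZl t u v : dot (t *: u) v = t * dot u v.
Proof. by rewrite mulr_sumr; apply: eq_bigr => i _; rewrite mxE mulrA. Qed.

Lemma dotDr u v w : dot w (u + v) = dot w u + dot w v.
Proof. by rewrite dotC dotDl !(dotC w). Qed.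

Lemma dotZr t u v : dot v (t *: u) = t * dot v u.
Proof. by rewrite dotC dotZl dotC. Qed.

Lemma dotNl u v : dot (- u) v = - dot u v.
Proof. by rewrite -scaleN1r dotZl mulN1r. Qed.

Lemma dotNr u v : dot v (- u) = - dot v u.
Proof. by rewrite dotC dotNl dotC. Qed.

Lemma dot_ge0 u : 0 <= dot u u.
Proof. by apply: sumr_ge0 => i _; rewrite -expr2 sqr_ge0. Qed.

Lemma dot_basis_r u (i : 'I_n) : dot u (basis_vec R i) = u 0 i.
Proof.
rewrite /dot (bigD1 i)//= big1 => [|j ji]; rewrite mxE !eqxx/= ?mulr1 ?addr0//.
by rewrite (negbTE ji) mulr0.
Qed.

Lemma dot_basis (i : 'I_n) : dot (basis_vec R i) (basis_vec R i) = 1.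
Proof. by rewrite dot_basis_r mxE !eqxx. Qed.

Lemma dot_line u i t : dot (u + t *: basis_vec R i) (u + t *: basis_vec R i) =
  dot u u + 2 * t * u 0 i + t ^+ 2.
Proof.
rewrite !(dotDl, dotDr, dotZl, dotZr) dot_basis (dotC (basis_vec R i)) dot_basis_r.
ring.
Qed.

Lemma sqr_enorm v : enorm v ^+ 2 = dot v v.
Proof. by rewrite sqr_sqrtr// dot_ge0. Qed.

Lemma enorm_ge0 v : 0 <= enorm v.
Proof. exact: sqrtr_ge0. Qed.

Lemma enormN v : enorm (- v) = enorm v.
Proof. by rewrite /enorm dotNl dotNr opprK. Qed.

Lemma enorm0 : enorm (0 : 'rV[R]_n) = 0.
Proof. by rewrite /enorm -(scale0r 0) dotZl mul0r sqrtr0. Qed.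

Lemma enormB u v : enorm (u - v) = enorm (v - u).
Proof. by rewrite -enormN opprB. Qed.

Lemma coord_le_enorm v i : `|v 0 i| <= enorm v.
Proof.
rewrite -sqrtr_sqr ler_wsqrtr//.
rewrite /dot (bigD1 i)//= expr2 lerDl sumr_ge0// => j _.
by rewrite -expr2 sqr_ge0.
Qed.

Lemma normr_le_enorm v : `|v| <= enorm v.
Proof.
rewrite /Num.norm/= mx_normrE; apply: bigmax_le; first exact: enorm_ge0.
by move=> [i j] _/=; rewrite ord1 coord_le_enorm.
Qed.

Lemma dot_le_enorm u v : dot u v <= enorm u * enorm v.
Proof.
have [v0|v0] := eqVneq (dot v v) 0.
  rewrite /dot big1 ?mulr_ge0 ?enorm_ge0// => i _.
  suff /eqP -> : v 0 i == 0 by rewrite mulr0.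
  rewrite -normr_le0 (le_trans (coord_le_enorm v i))//.
  by rewrite /enorm v0 sqrtr0.
have vv : 0 < dot v v by rewrite lt_neqAle eq_sym v0 dot_ge0.
have := dot_ge0 (dot v v *: u - dot u v *: v).
rewrite !(dotDl, dotDr, dotNl, dotNr, dotZl, dotZr) (dotC v u).
set x := dot u v; set y := dot v v in vv *; set z := dot u u.
move=> H; have {}H : 0 <= y * (z * y - x ^+ 2) by apply: le_trans H _; lra.
move: H; rewrite pmulr_rge0// subr_ge0 => H.
apply: le_trans (ler_norm _) _.
by rewrite -sqrtr_sqr /enorm -sqrtrM ?dot_ge0// ler_wsqrtr.
Qed.

Lemma enormD u v : enorm (u + v) <= enorm u + enorm v.
Proof.
rewrite -(@ler_pXn2r _ 2)// ?nnegrE ?addr_ge0 ?enorm_ge0//.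
rewrite sqr_enorm dotDl !dotDr (dotC v u) -!sqr_enorm.
have := dot_le_enorm u v; lra.
Qed.

Lemma enorm_triangle w u v : enorm (u - v) <= enorm (u - w) + enorm (w - v).
Proof. by rewrite -[X in enorm X <= _](subrKA w) enormD. Qed.

Lemma continuous_dot : continuous (fun v : 'rV[R]_n => dot v v).
Proof.
apply: (continuous_big (op := +%R)); first exact: add_continuous.
move=> i _ w.
apply: (@continuousM _ _ (fun u : 'rV[R]_n => u 0 i) (fun u : 'rV[R]_n => u 0 i));
  exact: (@coord_continuous R 1 n 0 i w).
Qed.

Lemma continuous_enorm : continuous (@enorm R n).
Proof.
move=> v; apply: continuous_comp; first exact: continuous_dot.
exact: sqrt_continuous.
Qed.

Lemma continuous_enormB w : continuous (fun v : 'rV[R]_n => enorm (v - w)).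
Proof.
move=> v; apply: continuous_comp; last exact: continuous_enorm.
by apply: (@continuousB _ _ _ id (cst w)); [exact: cvg_id|exact: cst_continuous].
Qed.

Lemma closed_enorm_annulus w (r1 r2 : R) :
  closed [set v : 'rV[R]_n | r1 <= enorm (v - w) <= r2].
Proof.
rewrite (_ : mkset _ = (fun v => enorm (v - w)) @^-1` `[r1, r2]).
  by apply: closed_comp => [x _|]; [exact: continuous_enormB|exact: interval_closed].
by apply/seteqP; split => v /=; rewrite in_itv.
Qed.

Lemma compact_enorm_annulus w (r1 r2 : R) :
  compact [set v : 'rV[R]_n | r1 <= enorm (v - w) <= r2].
Proof.
apply: bounded_closed_compact; last exact: closed_enorm_annulus.
exists (`|w| + r2); split; first exact: num_real.
move=> M wM v /andP[_ vr2]; apply: le_trans (ltW wM).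
rewrite -[v in `|v|](subrK w) addrC (le_trans (ler_normD _ _))// lerD2l.
exact: le_trans (normr_le_enorm _) vr2.
Qed.

End euclidean_norm.

(** * The maximum principle on an annulus *)

(** At the interior minimum [D 0 = 0]. If [s < 0], then [D] is negative just to the right of [0],
    and the mean value theorem gives [F m < F 0] for a small [m > 0]. *)
Lemma second_derivative_ge0 {R : realType} (F D : R -> R) (s e : R) :
  0 < e -> (forall t : R, `|t| < e -> is_derive t (1:R) F (D t)) ->
  is_derive (0:R) (1:R) D s -> (forall t : R, `|t| < e -> F 0 <= F t) -> 0 <= s.
Proof.
move=> e0 dF dD Fmin.
have itv t : t \in `]- e, e[%R -> `|t| < e by rewrite in_itv ltr_norml.
have D0 : D 0 = 0.
  have le0 : - e <= e by lra.
  have := @derive1_at_min R F (- e) e 0 le0 _ _ _.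
  have dF0 : is_derive (0:R) (1:R) F (D 0) by apply: dF; rewrite normr0.
  move=> H; rewrite -(@derive_val _ _ _ _ _ _ _ dF0).
  apply: derive_val; apply: H => [t /itv/dF[]//| |t /itv/Fmin//].
  by rewrite in_itv/= oppr_lt0 e0.
rewrite leNgt; apply/negP => s0.
have [d d0 dneg] : exists2 d, 0 < d & forall t, 0 < t < d -> D t < 0.
  case: dD => /cvg_ex[l /= Dl] Ds.
  have ls : l = s by rewrite -Ds /derive; apply/esym/cvg_lim.
  (* The difference quotients of [D] at [0] tend to [s < 0]; for [t > 0], with [D 0 = 0], their sign
     is that of [D t]. *)
  have : \forall h \near 0^', h^-1 *: (D (h *: (1 : R) + 0) - D 0) < 0.
    by apply: cvgr_lt Dl _ _; rewrite ls.
  rewrite /= => -[/= d d0 Hd]; exists d => // t /andP[t0 td].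
  have := Hd t; rewrite /= sub0r normrN gtr0_norm// => /(_ td).
  rewrite (gt_eqF t0) => /(_ isT); rewrite D0 subr0 addr0 [t%:A]mulr1.
  by rewrite [_ *: _]/(_ * _) pmulr_rlt0// invr_gt0.
(* Halving makes [m] strictly smaller than both radii. *)
pose m := Num.min d e / 2.
have [m0 md me] : [/\ 0 < m, m < d & m < e].
  have h : 0 < Num.min d e by rewrite lt_min d0 e0.
  have [h1 h2] : Num.min d e <= d /\ Num.min d e <= e by rewrite !ge_min !lexx orbT.
  rewrite /m; split; lra.
have dFm x : x \in `]0, m[%R -> is_derive x (1:R) F (D x).
  by rewrite in_itv/= => /andP[x0 xm]; apply: dF; rewrite gtr0_norm// (lt_trans xm).
have cF : {within `[0, m], continuous F}.
  apply: derivable_within_continuous => x; rewrite in_itv/= => /andP[x0 xm].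
  by have /dF[] : `|x| < e by rewrite ger0_norm// (le_lt_trans xm).
have [c] := MVT m0 dFm cF; rewrite in_itv/= subr0 => /andP[c0 cm] E.
have := Fmin m; rewrite gtr0_norm// => /(_ me).
rewrite -subr_ge0 E pmulr_lge0// leNgt dneg// c0/=; exact: lt_trans md.
Qed.

(** * Restriction to coordinate lines *)

Section lines.
Context {R : realType} {n : nat}.
Implicit Types (F H : 'rV[R]_n -> R) (p v : 'rV[R]_n) (i : 'I_n).

Definition line p i (t : R) : 'rV[R]_n := p + t *: basis_vec R i.

Lemma line0 p i : line p i 0 = p.
Proof. by rewrite /line scale0r addr0. Qed.

Lemma continuous_line p i : continuous (line p i).
Proof.
move=> t; apply: cvgD; first exact: cvg_cst.
by apply: cvgZr_tmp; exact: cvg_id.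
Qed.

(** Both sides are the same difference quotient, so derivability and the value of the derivative
    pass between [F] and its restriction to a line. *)
Lemma growth_rate_line F p i t :
  (fun h : R => h^-1 *: (F (h *: basis_vec R i + line p i t) - F (line p i t))) =
  (fun h : R => h^-1 *: ((F \o line p i) (h *: (1 : R) + t) - (F \o line p i) t)).
Proof.
apply/funext => h; congr (_ *: (F _ - _)).
by rewrite /line [h%:A]mulr1 scalerDl addrCA.
Qed.

Lemma partial_line F p i t : partial i F (line p i t) = 'D_1 (F \o line p i) t.
Proof.
by rewrite /partial /derive -growth_rate_line.
Qed.

Lemma derivable_line F p i t :
  derivable F (line p i t) (basis_vec R i) = derivable (F \o line p i) t 1.
Proof. by rewrite /derivable -growth_rate_line. Qed.

(** Exactly the regularity used by the second derivative test along each coordinate line; continuity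
    of the second partials is not included. *)
Definition C2_at F p := forall i,
  (\forall t \near (0 : R), derivable F (line p i t) (basis_vec R i)) /\
  derivable (partial i F) p (basis_vec R i).

(** The restriction of [F - K H] to each coordinate line through [p] has a local minimum at
    parameter [0]; the one-variable tests are summed over [i]. *)
Lemma le_laplacian_at_min F H (K : R) p : C2_at F p -> C2_at H p ->
  (\forall v \near p, F p - K * H p <= F v - K * H v) ->
  K * laplacian H p <= laplacian F p.
Proof.
move=> F2 H2 pmin; rewrite /laplacian mulr_sumr; apply: ler_sum => i _.
rewrite -subr_ge0.
have [Fn FD] := F2 i; have [Hn HD] := H2 i.
have mn : \forall t \near (0:R), F p - K * H p <= F (line p i t) - K * H (line p i t).
  have : line p i t @[t --> (0:R)] --> p.
    by rewrite -[X in _ --> X](line0 p i); exact: continuous_line.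
  by move=> /(_ _ pmin).
have [e /= e0 He] : \forall t \near (0:R), [/\ derivable F (line p i t) (basis_vec R i),
   derivable H (line p i t) (basis_vec R i) &
   F p - K * H p <= F (line p i t) - K * H (line p i t)] by near=> t; split; near: t.
apply: (@second_derivative_ge0 R (fun t => F (line p i t) - K * H (line p i t))
   (fun t => partial i F (line p i t) - K * partial i H (line p i t)) _ e e0).
- move=> t te; have [|+ + _] := He t; first by rewrite /= sub0r normrN.
  rewrite !derivable_line => /derivableP dF /derivableP dH.
  rewrite !partial_line.
  exact: (@is_deriveB _ _ _ (F \o line p i) (K \*: (H \o line p i)) _ _ _ _ dF
    (@is_deriveZ _ _ _ _ K _ _ _ dH)).
- have : derivable (partial i F \o line p i) 0 1 by rewrite -derivable_line line0.
  have : derivable (partial i H \o line p i) 0 1 by rewrite -derivable_line line0.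
  move=> /derivableP dH /derivableP dF.
  rewrite -[in X in partial i (partial i F) X](line0 p i).
  rewrite -[in X in partial i (partial i H) X](line0 p i) !partial_line.
  exact: (@is_deriveB _ _ _ (partial i F \o line p i)
    (K \*: (partial i H \o line p i)) _ _ _ _ dF (@is_deriveZ _ _ _ _ K _ _ _ dH)).
- move=> t te; have [|_ _] := He t; first by rewrite /= sub0r normrN.
  by rewrite line0.
Unshelve. all: by end_near. Qed.

End lines.

(** [F - K H] attains its minimum on the compact annulus. A negative minimum cannot lie on the
    boundary spheres, and at an interior one the strict inequality between the Laplacians
    contradicts [le_laplacian_at_min]. *)
Lemma annulus_comparison {R : realType} {n : nat} (F H : 'rV[R]_n -> R) (K : R)
    (w : 'rV[R]_n) (r1 r2 : R) :
  continuous F -> continuous H ->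
  (forall v : 'rV[R]_n, r1 < enorm (v - w) < r2 -> C2_at F v /\ C2_at H v) ->
  (forall v : 'rV[R]_n, r1 < enorm (v - w) < r2 -> F v < K * H v ->
    laplacian F v < K * laplacian H v) ->
  (forall v : 'rV[R]_n, enorm (v - w) = r1 \/ enorm (v - w) = r2 -> K * H v <= F v) ->
  forall v : 'rV[R]_n, r1 <= enorm (v - w) <= r2 -> K * H v <= F v.
Proof.
move=> cF cH C2 lap bnd v vA.
have cG : continuous (fun v : 'rV[R]_n => F v - K * H v).
  move=> x; apply: (@continuousB _ _ _ F (fun v : 'rV[R]_n => K * H v)); first exact: cF.
  by apply: (@continuousM _ _ (cst K) H); [exact: cst_continuous|exact: cH].
have A0 : [set v : 'rV[R]_n | r1 <= enorm (v - w) <= r2] !=set0 by exists v.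
have [p] := EVT_min_rV A0 (@compact_enorm_annulus R n w r1 r2)
  (continuous_subspaceT cG).
rewrite inE /= => /andP[p1 p2] pmin.
rewrite -subr_ge0 (le_trans _ (pmin _ _)) ?inE// subr_ge0 leNgt; apply/negP => Kp.
have p1' : r1 < enorm (p - w).
  rewrite lt_neqAle p1 andbT; apply/eqP => pr.
  by move: Kp; rewrite ltNge bnd//; left.
have p2' : enorm (p - w) < r2.
  rewrite lt_neqAle p2 andbT; apply/eqP => pr.
  by move: Kp; rewrite ltNge bnd//; right.
have pA : r1 < enorm (p - w) < r2 by rewrite p1'.
have [F2 H2] := C2 _ pA.
have := lap _ pA Kp; rewrite ltNge => /negP; apply.
apply: le_laplacian_at_min => //.
have c1 := @continuous_enormB R n w p.
have : \forall x \near p, r1 < enorm (x - w) < r2.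
  near=> x; apply/andP; split; near: x.
    exact: (cvgr_gt _ c1).
  exact: (cvgr_lt _ c1).
apply: filterS => x /andP[x1 x2]; apply: pmin; rewrite inE/=.
by rewrite !ltW.
Unshelve. all: by end_near. Qed.

(** * Barrier functions *)

(** Reduces second partials to one-variable calculus: [D] agrees with [partial i F] along the line
    near [0], so both have the same derivative at [0]. *)
Lemma second_partial_line {R : realType} {n : nat} (F : 'rV[R]_n -> R) p i
    (D : R -> R) (s : R) :
  (\forall t \near (0 : R), is_derive (t : R) (1 : R) (F \o line p i) (D t)) ->
  is_derive (0 : R) (1 : R) D s ->
  [/\ \forall t \near (0 : R), derivable F (line p i t) (basis_vec R i),
      derivable (partial i F) p (basis_vec R i) &
      partial i (partial i F) p = s].
Proof.
move=> dF dD.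
have E : \forall t \near (0 : R), D t = (partial i F \o line p i) t.
  near=> t; rewrite /= partial_line; apply/esym/derive_val.
  by near: t.
have [dL sL] := near_eq_is_derive E dD.
split.
- near=> t; rewrite derivable_line.
  have [] : is_derive (t : R) (1 : R) (F \o line p i) (D t) by near: t.
  by [].
- by move: dL; rewrite -derivable_line line0.
- by rewrite -[X in partial i _ X](line0 p i) partial_line.
Unshelve. all: by end_near. Qed.

Section barriers.
Context {R : realType} {n : nat}.
Implicit Types (v w p : 'rV[R]_n).

Let is_derive_quad (b c x : R) : is_derive x (1:R) (fun t : R => c + 2 * t * b + t ^+ 2)
  (2 * b + 2 * x).
Proof. by apply: is_derive_eq; rewrite /GRing.scale/=; lra. Qed.

Let is_derive_gauss (l b c x : R) : is_derive x (1:R)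
  (fun t : R => expR (- (l * (c + 2 * t * b + t ^+ 2))))
  (expR (- (l * (c + 2 * x * b + x ^+ 2))) * - (l * (2 * b + 2 * x))).
Proof.
have H := @is_deriveN _ _ _ _ _ _ _ (@is_deriveZ _ _ _ _ l _ _ _ (is_derive_quad b c x)).
exact: (is_derive1_comp (is_derive_expR _) H).
Qed.

Let is_derive2_gauss (l b c : R) : is_derive (0:R) (1:R)
  (fun x : R => expR (- (l * (c + 2 * x * b + x ^+ 2))) * - (l * (2 * b + 2 * x)))
  (expR (- (l * c)) * ((2 * l * b) ^+ 2 - 2 * l)).
Proof.
have H0 := is_derive_gauss l b c 0.
have H : is_derive (0:R) (1:R) (fun x : R => - (l * (2 * b + 2 * x))) (- (l * 2)).
  by apply: is_derive_eq; rewrite /GRing.scale/=; lra.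
apply: (@is_derive_eq _ _ _ _ _ _ _ _ (@is_deriveM _ _ _ _ _ _ _ _ H0 H)).
rewrite /GRing.scale/= !(mulr0, mul0r, expr0n, addr0)/=.
ring.
Qed.

(** The constant [k] is later taken to be the value of the Gaussian on the outer sphere, so that the
    barrier vanishes there. *)
Definition gaussian_barrier w (l k : R) v : R :=
  expR (- (l * enorm (v - w) ^+ 2)) - k.

Lemma gaussian_barrier_line w (l k : R) p i (t : R) :
  gaussian_barrier w l k (line p i t) =
  expR (- (l * (dot (p - w) (p - w) + 2 * t * (p - w) 0 i + t ^+ 2))) - k.
Proof. by rewrite /gaussian_barrier /line addrAC sqr_enorm dot_line. Qed.

Let gaussian_second w (l k : R) p i :
  [/\ \forall t \near (0 : R), derivable (gaussian_barrier w l k) (line p i t) (basis_vec R i),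
      derivable (partial i (gaussian_barrier w l k)) p (basis_vec R i) &
      partial i (partial i (gaussian_barrier w l k)) p =
        expR (- (l * dot (p - w) (p - w))) * ((2 * l * (p - w) 0 i) ^+ 2 - 2 * l)].
Proof.
apply: second_partial_line (is_derive2_gauss l ((p - w) 0 i) (dot (p - w) (p - w))).
near=> t.
have -> : gaussian_barrier w l k \o line p i = (fun t : R =>
    expR (- (l * (dot (p - w) (p - w) + 2 * t * (p - w) 0 i + t ^+ 2))) - k).
  by apply/funext => s; exact: gaussian_barrier_line.
have := @is_deriveB _ _ _ _ (cst k) _ _ _ _
  (is_derive_gauss l ((p - w) 0 i) (dot (p - w) (p - w)) t) (is_derive_cst _ _ _).
by rewrite subr0.
Unshelve. all: by end_near. Qed.

Lemma C2_gaussian_barrier w (l k : R) p : C2_at (gaussian_barrier w l k) p.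
Proof. by move=> i; have [] := gaussian_second w l k p i. Qed.

Lemma laplacian_gaussian_barrier w (l k : R) p :
  laplacian (gaussian_barrier w l k) p =
  expR (- (l * enorm (p - w) ^+ 2)) *
    (4 * l ^+ 2 * enorm (p - w) ^+ 2 - 2 * l * n%:R).
Proof.
rewrite sqr_enorm /laplacian.
transitivity (\sum_(i < n) expR (- (l * dot (p - w) (p - w))) *
    ((2 * l * (p - w) 0 i) ^+ 2 - 2 * l)).
  by apply: eq_bigr => i _; have [_ _ ->] := gaussian_second w l k p i.
rewrite -mulr_sumr sumrB; congr (_ * (_ - _)).
  by rewrite /dot mulr_sumr; apply: eq_bigr => i _; ring.
by rewrite sumr_const card_ord mulr_natr.
Qed.

Lemma continuous_gaussian_barrier w (l k : R) : continuous (gaussian_barrier w l k).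
Proof.
move=> v.
apply: (@continuousB _ _ _ (fun v : 'rV[R]_n => expR (- (l * enorm (v - w) ^+ 2))) (cst k));
  last exact: cst_continuous.
apply: continuous_comp; last exact: continuous_expR.
apply: (@continuousN _ _ _ (fun v : 'rV[R]_n => l * enorm (v - w) ^+ 2)).
apply: (@continuousM _ _ (cst l) (fun v : 'rV[R]_n => enorm (v - w) ^+ 2)).
  exact: cst_continuous.
apply: (@continuous_comp _ _ _ (fun v : 'rV[R]_n => enorm (v - w)) (fun x : R => x ^+ 2)).
  exact: continuous_enormB.
exact: exprn_continuous.
Qed.

(** On a coordinate line [dot v v] is a quadratic polynomial in the parameter, so no square root has
    to be differentiated. *)
Lemma enorm_powR v (b : R) : enorm v `^ b = dot v v `^ (b / 2).
Proof. by rewrite /enorm -powR12_sqrt ?dot_ge0// -powRrM mulrC. Qed.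

(** Only the existence of second partials is established: the Laplacian of [h] enters the theorem
    through its hypothesis. *)
Lemma C2_exp_powR (a b : R) p : 0 < enorm p ->
  C2_at (fun v : 'rV[R]_n => expR (- (a * enorm v `^ b))) p.
Proof.
move=> p0 i.
pose q (t : R) := dot p p + 2 * t * p 0 i + t ^+ 2.
have dq t : is_derive t (1:R) q (2 * p 0 i + 2 * t) by exact: is_derive_quad.
(* The rule for differentiating a real power is applied at positive bases; [q 0] is the squared norm
   of [p]. *)
have q0 : \forall t \near (0:R), 0 < q t.
  have [/derivable1_diffP/differentiable_continuous cq _] := dq 0.
  apply: (cvgr_gt _ cq); rewrite /q mulr0 mul0r expr0n !addr0.
  by rewrite -sqr_enorm exprn_gt0.
pose c := b / 2.
have dh t : 0 < q t -> is_derive t (1:R) (fun t => expR (- (a * q t `^ c)))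
    (expR (- (a * q t `^ c)) * - (a * (c * q t `^ (c - 1) * (2 * p 0 i + 2 * t)))).
  move=> qt.
  have H := is_derive1_comp (is_derive1_powR c qt) (dq t).
  exact: (is_derive1_comp (is_derive_expR _)
     (@is_deriveN _ _ _ _ _ _ _ (@is_deriveZ _ _ _ _ a _ _ _ H))).
have [s ds] : exists s, is_derive (0:R) (1:R) (fun t => expR (- (a * q t `^ c)) *
    - (a * (c * q t `^ (c - 1) * (2 * p 0 i + 2 * t)))) s.
  have qq := nbhs_singleton q0.
  have H1 := dh _ qq.
  have H2 := is_derive1_comp (is_derive1_powR (c - 1) qq) (dq 0).
  have H3 : is_derive (0:R) (1:R) (fun t : R => 2 * p 0 i + 2 * t) 2.
    by apply: is_derive_eq; rewrite /GRing.scale/=; lra.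
  have H4 := @is_deriveM _ _ _ _ _ _ _ _ (@is_deriveZ _ _ _ _ c _ _ _ H2) H3.
  have H5 := @is_deriveN _ _ _ _ _ _ _ (@is_deriveZ _ _ _ _ a _ _ _ H4).
  eexists; exact: (@is_deriveM _ _ _ _ _ _ _ _ H1 H5).
have [] := @second_partial_line R n (fun v => expR (- (a * enorm v `^ b))) p i _ s _ ds;
  last by [].
near=> t.
have -> : (fun v => expR (- (a * enorm v `^ b))) \o line p i =
    (fun t : R => expR (- (a * q t `^ c))).
  by apply/funext => x; rewrite /= enorm_powR /line dot_line.
by apply: dh; near: t.
Unshelve. all: by end_near. Qed.

Lemma continuous_exp_powR (a : R) :
  continuous (fun v : 'rV[R]_n => expR (- (a * enorm v `^ (3 / 2)))).
Proof.
(* Writing the power as [enorm v * Num.sqrt (enorm v)] gives continuity at the origin too. *)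
have -> : (fun v : 'rV[R]_n => expR (- (a * enorm v `^ (3 / 2)))) =
    (fun v => expR (- (a * (enorm v * Num.sqrt (enorm v))))).
  apply/funext => v; rewrite (_ : 3 / 2 = 1 + 2^-1); last by lra.
  rewrite powRD; last by rewrite gt_eqF// addr_gt0// invr_gt0.
  by rewrite powRr1 ?powR12_sqrt ?enorm_ge0.
move=> v.
apply: continuous_comp; last exact: continuous_expR.
apply: (@continuousN _ _ _ (fun v : 'rV[R]_n => a * (enorm v * Num.sqrt (enorm v)))).
apply: (@continuousM _ _ (cst a) (fun v : 'rV[R]_n => enorm v * Num.sqrt (enorm v))).
  exact: cst_continuous.
apply: (@continuousM _ _ (fun v : 'rV[R]_n => enorm v) (fun v : 'rV[R]_n => Num.sqrt (enorm v))).
  exact: continuous_enorm.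
apply: continuous_comp; first exact: continuous_enorm.
exact: sqrt_continuous.
Qed.

End barriers.

(** * Integrals against Lebesgue measure on R^n *)

Section integral_lower_bound.
Context d (T : measurableType d) (R : realType).
Variable mu : {measure set T -> \bar R}.
Local Open Scope ereal_scope.

(* The integral is a supremum over simple functions below the integrand, so no
   measurability is needed; this avoids proving it for the gain term. *)
Lemma ge0_le_integral_nomeas (F G : T -> \bar R) : (forall x, 0 <= F x) ->
  (forall x, F x <= G x) -> \int[mu]_x F x <= \int[mu]_x G x.
Proof.
move=> F0 FG; have G0 x : 0 <= G x by exact: le_trans (FG x).
rewrite !ge0_integralTE//; apply: le_ereal_sup => _ [h /= hF <-].
by exists h => // x; exact: le_trans (FG x).
Qed.

(** The integral of [F] is that of its positive part minus that of its negative part; the latter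
    part is at most [G]. *)
Lemma integral_geN (F G : T -> \bar R) : (forall x, 0 <= G x) ->
  (forall x, - G x <= F x) -> - (\int[mu]_x G x) <= \int[mu]_x F x.
Proof.
move=> G0 GF; rewrite [leRHS]integralE.
have h : \int[mu]_x F^\- x <= \int[mu]_x G x.
  apply: ge0_le_integral_nomeas => x //.
  by rewrite funenegE ge_max G0 andbT leeNl.
have p : 0 <= \int[mu]_x F^\+ x by apply: integral_ge0.
have n0 : 0 <= \int[mu]_x F^\- x by apply: integral_ge0.
rewrite -[leLHS]add0e leeD// leeN2//.
Qed.

End integral_lower_bound.

(** * The Lebesgue measure of a cube *)

Section box.
Context {R : realType}.

Definition box n (w : 'rV[R]_n) (e : R) : set 'rV[R]_n :=
  [set v | forall i, `|v 0 i - w 0 i| <= e].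

Lemma measurable_box n (w : 'rV[R]_n) e : measurable (box w e).
Proof.
have -> : box w e = \bigcap_(i in [set: 'I_n])
    ((fun v : 'rV[R]_n => v 0 i) @^-1` `[w 0 i - e, w 0 i + e]).
  apply/seteqP; split => v /= H i; first by move=> _; rewrite /= in_itv/= -ler_distl H.
  by have := H i I; rewrite /= in_itv/= -ler_distl.
apply: fin_bigcap_measurable; first exact: finite_finset.
move=> i _; rewrite -[X in measurable X]setTI.
by apply: measurable_coord => //; exact: measurable_itv.
Qed.

(** Induction on the dimension: the preimage of a cube under [rV_cons] is a cube of one dimension
    less times an interval. In dimension [0] the cube is the single point carrying the Dirac
    mass. *)
Lemma lebesgue_rV_box n (w : 'rV[R]_n) e : 0 < e ->
  lebesgue_rV R n (box w e) = ((2 * e) ^+ n)%:E.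
Proof.
move=> e0; elim: n w => [|n IH] w.
  rewrite /= diracE expr0 mem_set//; by case.
pose w' : 'rV[R]_n := @rsubmx R 1 1 n w.
pose x : R := w 0 (@lshift 1 n ord0).
have cl v t : @rV_cons R n (v, t) 0 (@lshift 1 n ord0) = t.
  by apply: etrans (row_mxEl _ _ _ _) _; rewrite mxE.
have cr v t j : @rV_cons R n (v, t) 0 (@rshift 1 n j) = v 0 j.
  exact: row_mxEr.
have E : @rV_cons R n @^-1` box w e = box w' e `*` `[x - e, x + e].
  apply/seteqP; split => [[v t] /= H|[v t] /= [H1 H2] i].
    split => [i|]; first by have := H (@rshift 1 n i); rewrite cr /w' mxE.
    by have := H (@lshift 1 n ord0); rewrite cl in_itv/= -ler_distl.
  have [j ->|j ->] := @split_ordP 1 n i.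
    by rewrite ord1 cl; move: H2; rewrite in_itv/= -ler_distl.
  by rewrite cr; have := H1 j; rewrite /w' mxE.
transitivity ((lebesgue_rV R n \x lebesgue_measure)%E (@rV_cons R n @^-1` box w e)).
  by [].
rewrite E product_measure1E//; last exact: measurable_box.
have L : @lebesgue_measure R `[x - e, x + e]%classic = (2 * e)%:E.
  rewrite lebesgue_measure_itv/= lte_fin ifT; last by lra.
  by rewrite -EFinD; congr EFin; lra.
transitivity (((2 * e) ^+ n)%:E * (2 * e)%:E)%E.
  by congr (_ * _)%E; [exact: IH|exact: L].
by rewrite -EFinM exprSr.
Qed.
End box.

(** * Integrability with the weight, and the convolution with the norm *)

Section L11.
Context {R : realType} {n : nat}.
Implicit Types (v w x : 'rV[R]_n).
Local Notation mu := (lebesgue_rV R n).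

(** By continuity [G] exceeds [G x / 2] on a small cube around [x], and the cube has positive
    measure. *)
Lemma integral_gt0_at (G : 'rV[R]_n -> R) x : measurable_fun setT G ->
  (forall v, 0 <= G v) -> {for x, continuous G} -> 0 < G x ->
  (0 < \int[mu]_v (G v)%:E)%E.
Proof.
move=> mG G0 cG Gx.
have : \forall v \near x, G x / 2 < G v by apply: (cvgr_gt _ cG); lra.
move=> /nbhs_ballP[e /= e0 He].
have bG v : box x (e / 2) v -> G x / 2 <= G v.
  move=> bv; apply/ltW/He; split => // i j; rewrite ord1.
  by have := bv j; rewrite distrC /ball/=; lra.
have mb := measurable_box x (e / 2).
apply: (@lt_le_trans _ _ (\int[mu]_(v in box x (e / 2)) (G x / 2)%:E)%E).
  rewrite integral_cst// lebesgue_rV_box; last by lra.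
  rewrite lte_fin mulr_gt0 ?exprn_gt0//; lra.
apply: (@le_trans _ _ (\int[mu]_(v in box x (e / 2)) (G v)%:E)%E).
  apply: ge0_le_integral => //.
  - by move=> v _; rewrite lee_fin; lra.
  - by apply/measurable_EFinP; exact: measurable_funTS.
apply: ge0_subset_integral => //; first exact/measurable_EFinP.
by move=> v _; rewrite lee_fin.
Qed.

Lemma measurable_enormB w : measurable_fun setT (fun v : 'rV[R]_n => enorm (v - w)).
Proof.
apply: (measurableT_comp (@measurable_enorm R n)).
apply: measurable_fun_rV => i.
under eq_fun do rewrite mxE.
by apply: measurable_funD => //; exact: measurable_coord.
Qed.

Context (f : 'rV[R]_n -> R) (f0 : forall v, 0 <= f v) (fL : L11 f).

(** Integrability makes [f] times the weight measurable; dividing by the positive measurable weight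
    recovers [f]. *)
Lemma L11_measurable : measurable_fun setT f.
Proof.
have s0 v : 0 < Num.sqrt (1 + enorm v ^+ 2).
  by rewrite sqrtr_gt0 ltr_wpDr ?sqr_ge0.
have -> : f = (fun v => (f v * Num.sqrt (1 + enorm v ^+ 2)) *
    Num.sqrt (1 + enorm v ^+ 2) `^ (-1)).
  by apply/funext => v; rewrite powR_inv1 ?ltW// mulfK// gt_eqF.
apply: measurable_funM.
  by apply/measurable_EFinP; case/integrableP: fL.
apply: (measurableT_comp (f := @powR R ^~ (- 1))) => //.
have ms : measurable_fun setT (@Num.sqrt R).
  by apply: continuous_measurable_fun; exact: sqrt_continuous.
apply: (measurableT_comp ms); apply: measurable_funD => //.
apply: measurable_funX; exact: measurable_enorm.
Qed.

(** Domination by [2 * C] times the weighted [f], since [1 + |v|] is at most twice the square root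
    of [1 + |v|^2]. *)
Lemma L11_le_integrable (G : 'rV[R]_n -> R) (C : R) : measurable_fun setT G ->
  (forall v, `|G v| <= C * (f v * (1 + enorm v))) ->
  mu.-integrable setT (EFin \o G).
Proof.
move=> mG GC.
have fC := @integrableZl _ _ _ mu setT measurableT (2 * C) _ fL.
apply: (le_integrable measurableT _ _ fC); first exact/measurable_EFinP.
move=> v _; rewrite /= lee_fin (le_trans (GC v))// (le_trans _ (ler_norm _))//.
have C0 : 0 <= C * (f v * (1 + enorm v)) by exact: le_trans (GC v).
have e0 := enorm_ge0 v.
set s := Num.sqrt _.
have s1 : 1 + enorm v <= 2 * s.
  have h1 : 1 <= s by rewrite -sqrtr1 ler_wsqrtr// lerDl sqr_ge0.
  have h2 : enorm v <= s.
    by rewrite -[leLHS](ger0_norm e0) -sqrtr_sqr ler_wsqrtr// lerDr.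
  lra.
(* The sign of [C] can be read off the bound only where [f v] is positive. *)
have [->|fv] := eqVneq (f v) 0; first by rewrite !(mul0r, mulr0).
have fvp : 0 < f v by rewrite lt_neqAle eq_sym fv f0.
have CC : 0 <= C by move: C0; rewrite pmulr_lge0// mulr_gt0//; lra.
rewrite [leRHS](_ : _ = C * (f v * (2 * s))); last by ring.
by rewrite ler_wpM2l// ler_wpM2l.
Qed.

Lemma L11_integrable : mu.-integrable setT (EFin \o f).
Proof.
apply: (@L11_le_integrable f 1); first exact: L11_measurable.
move=> v; rewrite ger0_norm// mul1r ler_peMr// lerDl; exact: enorm_ge0.
Qed.

Lemma measurable_fenormB v : measurable_fun setT (fun w => f w * enorm (v - w)).
Proof.
apply: measurable_funM; first exact: L11_measurable.
under eq_fun do rewrite enormB.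
exact: measurable_enormB.
Qed.

Lemma L11_integrable_enorm v : mu.-integrable setT (EFin \o (fun w => f w * enorm (v - w))).
Proof.
apply: (@L11_le_integrable _ (1 + enorm v)); first exact: measurable_fenormB.
move=> w; rewrite ger0_norm ?mulr_ge0 ?enorm_ge0//.
rewrite mulrCA ler_wpM2l//.
have := enormD v (- w); rewrite enormN.
have := enorm_ge0 v; have := enorm_ge0 w; nra.
Qed.

Lemma conv_normE v : (conv_norm f v)%:E = (\int[mu]_w (f w * enorm (v - w))%:E)%E.
Proof.
rewrite /conv_norm /Rintegral fineK//.
exact: (integrable_fin_num measurableT (L11_integrable_enorm v)).
Qed.

Lemma conv_norm_ge0 v : 0 <= conv_norm f v.
Proof. by apply: Rintegral_ge0 => w _; rewrite mulr_ge0 ?enorm_ge0. Qed.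

(** The triangle inequality integrated against [f]: the convolution is Lipschitz with constant the
    mass, hence bounded on balls. *)
Lemma conv_norm_le v w : conv_norm f v <= conv_norm f w + enorm (v - w) * \int[mu]_x f x.
Proof.
have i1 := L11_integrable.
have i2 : mu.-integrable setT (EFin \o (fun x => enorm (v - w) * f x)).
  exact: (integrableZl measurableT _ i1).
rewrite -(RintegralZl _ measurableT i1) -RintegralD//; last exact: L11_integrable_enorm.
apply: le_Rintegral => //.
- exact: L11_integrable_enorm.
- exact: (integrableD measurableT (L11_integrable_enorm w) i2).
- move=> x _; rewrite [enorm _ * _]mulrC -mulrDr ler_wpM2l//.
  by have := enorm_triangle w v x; lra.
Qed.

Lemma conv_norm_gt0 v x : {for x, continuous f} -> 0 < f x -> 0 < enorm (v - x) ->
  0 < conv_norm f v.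
Proof.
move=> cf fx vx; rewrite -lte_fin conv_normE.
apply: (@integral_gt0_at (fun w => f w * enorm (v - w)) x).
- exact: measurable_fenormB.
- by move=> w; rewrite mulr_ge0 ?enorm_ge0.
- apply: (@continuousM _ _ f (fun w : 'rV[R]_n => enorm (v - w))) => //.
  rewrite (_ : (fun w => enorm (v - w)) = fun w : 'rV[R]_n => enorm (w - v)).
    exact: continuous_enormB.
  by apply/funext => w; rewrite enormB.
- by rewrite mulr_gt0.
Qed.

End L11.

(** * The collision operator against a localized test function *)

Section collision_lower_bound.
Context {R : realType} {n : nat} (alpha c : R).
Hypothesis hc : kernel_normalized n c.
Implicit Types (u v w s : 'rV[R]_n).
Local Notation mu := (lebesgue_rV R n).

Lemma kernel_b_ge0 u s : 0 <= kernel_b c u s.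
Proof. by rewrite mulr_ge0 ?powR_ge0//; case: hc => /ltW. Qed.

Lemma measurable_kernel_b u : measurable_fun setT (kernel_b c u).
Proof.
apply: measurable_funM => //.
apply: (measurableT_comp (f := @powR R ^~ _)) => //.
apply: measurable_funM => //; apply: measurable_funB => //.
rewrite (_ : dot _ = fun s => \sum_(i < n) edir u 0 i * s 0 i) //.
by apply: measurable_sum => i; apply: measurable_funM => //; exact: measurable_coord.
Qed.

Lemma integral_linear (U V : 'rV[R]_n -> R) (a b : R) :
  mu.-integrable setT (EFin \o U) -> mu.-integrable setT (EFin \o V) ->
  (\int[mu]_x (a * U x + b * V x)%:E =
    (a * (\int[mu]_x U x) + b * (\int[mu]_x V x))%:E)%E.
Proof.
move=> iU iV.
have iaU : mu.-integrable setT (EFin \o (fun x => a * U x)) := integrableZl measurableT a iU.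
have ibV : mu.-integrable setT (EFin \o (fun x => b * V x)) := integrableZl measurableT b iV.
rewrite -!RintegralZl// -RintegralD// /Rintegral fineK//.
apply: (integrable_fin_num measurableT); exact: (integrableD measurableT iaU ibV).
Qed.

Context (f psi : 'rV[R]_n -> R) (v0 : 'rV[R]_n) (e : R).
Hypotheses (f0 : forall v, 0 <= f v) (fL : L11 f) (e0 : 0 <= e).
Hypotheses (psi0 : forall v, 0 <= psi v)
  (psi_supp : forall v, e < enorm (v - v0) -> psi v = 0)
  (fpsi : mu.-integrable setT (fun v => (f v * psi v)%:E)).

(** The gain terms [psi'] and [psi'_*] are nonnegative and are dropped; the remaining factor does
    not depend on [s], and the kernel integrates to [1]. *)
Let inner_lower v w :
  (- (f v * f w * (psi v + psi w) * enorm (v - w))%:E <=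
  \int[sphere_measure R n]_s
     (f v * f w *
      (psi (post_v alpha v w s) + psi (post_w alpha v w s) - psi v - psi w) *
      enorm (v - w) * kernel_b c (v - w) s)%:E)%E.
Proof.
(* The kernel is normalized for nonzero relative velocity only; at [v = w] the factor
   [enorm (v - w)] makes both sides vanish. *)
have [->|vw] := eqVneq (v - w) 0.
  rewrite enorm0 mulr0 oppe0 integral0_eq// => s _.
  by rewrite mulr0 mul0r.
set C := f v * f w * (psi v + psi w) * enorm (v - w).
have C0 : 0 <= C by rewrite !mulr_ge0 ?addr_ge0 ?enorm_ge0.
have [_ /(_ _ vw) b1] := hc.
have -> : (C%:E = \int[sphere_measure R n]_s (C%:E * (kernel_b c (v - w) s)%:E))%E.
  rewrite ge0_integralZl//; first by rewrite b1 mule1.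
    by apply/measurable_EFinP; exact: measurable_kernel_b.
  by move=> s _; rewrite lee_fin kernel_b_ge0.
apply: integral_geN => s.
  by rewrite -EFinM lee_fin mulr_ge0// kernel_b_ge0.
rewrite -EFinM -EFinN lee_fin -mulNr ler_wpM2r ?kernel_b_ge0// /C -mulNr.
rewrite ler_wpM2r ?enorm_ge0// -mulrN ler_wpM2l ?mulr_ge0//.
have := psi0 (post_v alpha v w s); have := psi0 (post_w alpha v w s); lra.
Qed.

(* Half of the loss comes from [psi v], half from [psi w]; no exchange of integrals
   is needed since [|v - w| <= |v0 - w| + e] when [psi v != 0]. *)
Lemma collision_weak_ge :
  (- ((conv_norm f v0 + e * \int[mu]_x f x) * \int[mu]_x (f x * psi x))%:E
    <= collision_weak alpha c f psi)%E.
Proof.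
pose U x := f x * psi x.
pose V x := f x * enorm (v0 - x) + e * f x.
pose M := conv_norm f v0 + e * \int[mu]_x f x.
pose J := \int[mu]_x U x.
have fI := L11_integrable f0 fL.
have kI := L11_integrable_enorm f0 fL v0.
have eI : mu.-integrable setT (EFin \o (fun x => e * f x)) := integrableZl measurableT e fI.
have VI : mu.-integrable setT (EFin \o V) := integrableD measurableT kI eI.
have VM : \int[mu]_x V x = M by rewrite RintegralD// RintegralZl.
have U0 x : 0 <= U x by rewrite mulr_ge0.
have V0 x : 0 <= V x by rewrite addr_ge0// mulr_ge0 ?enorm_ge0.
have M0 : 0 <= M by rewrite -VM; exact: Rintegral_ge0.
have J0 : 0 <= J by exact: Rintegral_ge0.
have UV v w : f v * f w * psi v * enorm (v - w) <= U v * V w.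
  have [ev|ve] := ltP e (enorm (v - v0)).
    by rewrite psi_supp// !(mulr0, mul0r) mulr_ge0.
  rewrite [leRHS](_ : _ = f v * f w * psi v * (enorm (v0 - w) + e));
    last by rewrite /U /V; ring.
  rewrite ler_wpM2l ?mulr_ge0//.
  by have := enorm_triangle v0 v w; lra.
have H v w : f v * f w * (psi v + psi w) * enorm (v - w) <= V w * U v + U w * V v.
  have := UV v w; have := UV w v; rewrite (enormB w v); lra.
(* The iterated integral is bounded one layer at a time: [U] integrates to [J] and [V] to [M], so
   the [v]-integral of the majorant is again a combination of [U w] and [V w]. *)
have mid w : (- (J * V w + M * U w)%:E <= \int[mu]_v \int[sphere_measure R n]_s
     (f v * f w *
      (psi (post_v alpha v w s) + psi (post_w alpha v w s) - psi v - psi w) *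
      enorm (v - w) * kernel_b c (v - w) s)%:E)%E.
  have -> : ((J * V w + M * U w)%:E = \int[mu]_v (V w * U v + U w * V v)%:E)%E.
    by rewrite integral_linear// VM; congr EFin; rewrite /J; ring.
  apply: integral_geN => v; first by rewrite lee_fin addr_ge0 ?mulr_ge0.
  apply: le_trans (inner_lower v w); rewrite leeN2 lee_fin; exact: H.
rewrite /collision_weak.
(* The factor [2] is cancelled by the one half in the weak form. *)
have out : (- (2 * (M * J))%:E <= \int[mu]_w \int[mu]_v \int[sphere_measure R n]_s
     (f v * f w *
      (psi (post_v alpha v w s) + psi (post_w alpha v w s) - psi v - psi w) *
      enorm (v - w) * kernel_b c (v - w) s)%:E)%E.
  have -> : ((2 * (M * J))%:E = \int[mu]_w (J * V w + M * U w)%:E)%E.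
    by rewrite integral_linear// VM; congr EFin; rewrite /J; ring.
  apply: integral_geN => w; last exact: mid.
  by rewrite lee_fin addr_ge0 ?mulr_ge0.
rewrite -[leLHS]mul1e (_ : (1 = (2^-1)%:E * 2%:E)%E); last by rewrite -EFinM mulVf.
rewrite -muleA lee_wpmul2l ?lee_fin ?invr_ge0//.
by apply: le_trans out; rewrite muleN -EFinM.
Qed.

End collision_lower_bound.

(** * Localized test functions *)

Section bump.
Context {R : realType} {n : nat}.
Implicit Types (v w : 'rV[R]_n).

(* Twice the positive part of [e - |v - w|]; avoids [Num.max]. *)
Definition bump w (e : R) v : R := e - enorm (v - w) + `|e - enorm (v - w)|.

Lemma bump_ge0 w e v : 0 <= bump w e v.
Proof. by rewrite /bump addrC -[X in _ + X]opprK subr_ge0 -normrN ler_norm. Qed.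

Lemma bump_eq0 w e v : e <= enorm (v - w) -> bump w e v = 0.
Proof. by move=> ev; rewrite /bump ler0_norm ?subr_le0// subrr. Qed.

Lemma bump_center w e : 0 < e -> 0 < bump w e w.
Proof. by move=> e0; rewrite /bump subrr enorm0 subr0 gtr0_norm// addr_gt0. Qed.

Lemma bump_le w e v : 0 <= e -> bump w e v <= 2 * e.
Proof.
move=> e0; have [ev|ve] := leP e (enorm (v - w)).
  by rewrite bump_eq0// mulr_ge0.
rewrite /bump gtr0_norm ?subr_gt0//; have := enorm_ge0 (v - w); lra.
Qed.

Lemma continuous_bump w e : continuous (bump w e).
Proof.
have c : continuous (fun v : 'rV[R]_n => e - enorm (v - w)).
  move=> v; apply: (@continuousB _ _ _ (cst e) (fun v : 'rV[R]_n => enorm (v - w))).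
    exact: cst_continuous.
  exact: continuous_enormB.
move=> v; apply: (@continuousD _ _ _ (fun v : 'rV[R]_n => e - enorm (v - w))
  (fun v : 'rV[R]_n => `|e - enorm (v - w)|)); first exact: c.
by apply: continuous_comp; [exact: c|exact: norm_continuous].
Qed.

Lemma measurable_bump w e : measurable_fun setT (bump w e).
Proof.
have m : measurable_fun setT (fun v : 'rV[R]_n => e - enorm (v - w)).
  by apply: measurable_funB => //; exact: measurable_enormB.
by apply: measurable_funD => //; exact: measurableT_comp.
Qed.

Lemma test_fun_bump w e : test_fun (bump w e).
Proof.
split; first exact: continuous_bump.
apply: subclosed_compact (@compact_enorm_annulus R n w 0 e) _.
  exact: closed_closure.
rewrite [X in _ `<=` X]((closure_id _).1 (@closed_enorm_annulus R n w 0 e)).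
apply: closure_subset => v /= b0; rewrite enorm_ge0/= leNgt; apply/negP => ev.
by move: b0; rewrite bump_eq0 ?eqxx// ltW.
Qed.

End bump.

(** * The pointwise bound of the collision term by the loss term *)

Section loss_bound.
Context {R : realType} {n : nat} (alpha c : R).
Hypothesis hc : kernel_normalized n c.
Context (f Q : 'rV[R]_n -> R).
Hypotheses (f0 : forall v, 0 <= f v) (fL : L11 f).
Hypotheses (cf : continuous f) (cQ : continuous Q).
Hypothesis hQ : is_collision alpha c f Q.
Local Notation mu := (lebesgue_rV R n).

(** If this failed, then by continuity [Q + (g + eta) f] would be negative near [v0] for some
    [eta > 0]. The bound [collision_weak_ge] for a bump of small radius [e] has error at most [eta],
    which is a contradiction. *)
Lemma collision_ge_loss v0 : 0 <= Q v0 + conv_norm f v0 * f v0.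
Proof.
rewrite leNgt; apply/negP => neg.
set g := conv_norm f v0 in neg.
have [eta eta0 neg'] : exists2 eta, 0 < eta & Q v0 + (g + eta) * f v0 < 0.
  have fp : 0 < f v0 + 1 by have := f0 v0; lra.
  (* Small enough that [eta * f v0] stays below the gap [k]; adding [1] keeps the denominator
     positive when [f v0 = 0]. *)
  exists (- (Q v0 + g * f v0) / (2 * (f v0 + 1))).
    by rewrite divr_gt0 ?oppr_gt0// mulr_gt0.
  set k := - _; have k0 : 0 < k by rewrite oppr_gt0.
  suff : k / (2 * (f v0 + 1)) * f v0 < k by rewrite /k mulrDl; lra.
  rewrite mulrAC ltr_pdivrMr ?mulr_gt0// ltr_pM2l//; have := f0 v0; lra.
have [d d0 Hd] : exists2 d, 0 < d &
    forall v, enorm (v - v0) < d -> Q v + (g + eta) * f v < 0.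
  have cL : {for v0, continuous (fun v => Q v + (g + eta) * f v)}.
    apply: (@continuousD _ _ _ Q (fun v => (g + eta) * f v)); first exact: cQ.
    by apply: (@continuousM _ _ (cst (g + eta)) f); [exact: cst_continuous|exact: cf].
  have : \forall v \near v0, Q v + (g + eta) * f v < 0 by apply: (cvgr_lt _ cL).
  move=> /nbhs_ballP[d /= d0 Hd]; exists d => // v vd; apply: Hd; split => // i j.
  rewrite ord1 /ball/= distrC; apply: le_lt_trans vd.
  by have := coord_le_enorm (v - v0) j; rewrite !mxE.
pose m := \int[mu]_x f x.
have m0 : 0 <= m by exact: Rintegral_ge0.
(* [e <= d] keeps the bump inside the neighbourhood found above, and [e * m <= eta] absorbs the
   error of [collision_weak_ge]. *)
pose e := Num.min d (eta / (m + 1)).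
have e0 : 0 < e by rewrite lt_min d0 divr_gt0// ltr_wpDl.
have ed : e <= d by rewrite ge_min lexx.
have em : e * m <= eta.
  apply: (@le_trans _ _ (eta / (m + 1) * m)).
    by rewrite ler_wpM2r// ge_min lexx orbT.
  by rewrite mulrAC ler_pdivrMr ?ltr_wpDl// ler_pM2l//; lra.
pose psi := bump v0 e.
have psi0 v : 0 <= psi v by exact: bump_ge0.
have fpsi : mu.-integrable setT (EFin \o (fun v => f v * psi v)).
  apply: (@L11_le_integrable _ _ f f0 fL _ (2 * e)).
    by apply: measurable_funM; [exact: L11_measurable|exact: measurable_bump].
  move=> v; rewrite ger0_norm ?mulr_ge0// mulrCA ler_wpM2l//.
  have := bump_le v0 v (ltW e0); rewrite -/psi; have := enorm_ge0 v; nra.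
have [Qpsi Qeq] := hQ (test_fun_bump v0 e).
have low := @collision_weak_ge R n alpha c hc f psi v0 e f0 fL (ltW e0) psi0
  (fun v ev => bump_eq0 (ltW ev)) fpsi.
have Qr : (\int[mu]_v (Q v * psi v)%:E = (\int[mu]_v (Q v * psi v))%:E)%E.
  by rewrite /Rintegral fineK//; exact: (integrable_fin_num measurableT Qpsi).
move: low; rewrite -Qeq Qr lee_fin -/g -/m => low.
(* The weak form makes the integral of [G] at most [0], whereas [G] is nonnegative, continuous and
   positive at [v0]. *)
pose G v := - 1 * (Q v * psi v) + - (g + e * m) * (f v * psi v).
have GE v : G v = - (Q v + (g + e * m) * f v) * psi v by rewrite /G; ring.
have : (0 < \int[mu]_v (G v)%:E)%E.
  apply: (@integral_gt0_at _ _ G v0).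
  - apply: measurable_funD; apply: measurable_funM => //; apply/measurable_EFinP.
      by case/integrableP: Qpsi.
    by case/integrableP: fpsi.
  - move=> v; rewrite GE; have [ev|ve] := leP e (enorm (v - v0)).
      by rewrite /psi bump_eq0// mulr0.
    rewrite mulr_ge0// oppr_ge0 (le_trans _ (ltW (Hd v _)))//; last exact: lt_le_trans ed.
    by rewrite lerD2l ler_wpM2r// lerD2l.
  - rewrite (_ : G = fun v => - (Q v + (g + e * m) * f v) * psi v); last exact/funext.
    apply: (@continuousM _ _ (fun v => - (Q v + (g + e * m) * f v)) psi);
      last exact: continuous_bump.
    apply: (@continuousN _ _ _ (fun v => Q v + (g + e * m) * f v)).
    apply: (@continuousD _ _ _ Q (fun v => (g + e * m) * f v)); first exact: cQ.
    by apply: (@continuousM _ _ (cst (g + e * m)) f); [exact: cst_continuous|exact: cf].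
  - rewrite GE mulr_gt0 ?bump_center// oppr_gt0 (le_lt_trans _ neg')//.
    by rewrite lerD2l ler_wpM2r// lerD2l.
rewrite (integral_linear _ _ Qpsi fpsi) lte_fin; lra.
Qed.

End loss_bound.

(** * Lower bounds for supersolutions *)

Section smooth_functions.
Context {R : realType} {n : nat}.
Implicit Types (F : 'rV[R]_n -> R) (p v : 'rV[R]_n).

Lemma smooth_continuous F : smooth F -> continuous F.
Proof. by move=> /(_ 0). Qed.

Lemma smooth_C2_at F p : smooth F -> C2_at F p.
Proof.
move=> /(_ 2%N)[_ F2] i; have [dF [_ dF2]] := F2 i.
by split; [exact: filterE|have [] := dF2 i].
Qed.

(** Through the equation this makes [Q] continuous, so that its weak form yields information at
    every point. *)
Lemma smooth_continuous_laplacian F : smooth F -> continuous (laplacian F).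
Proof.
move=> /(_ 2%N)[_ F2].
apply: (continuous_big (op := +%R)); first exact: add_continuous.
by move=> i _; have [_ [_ /(_ i)[_]]] := F2 i.
Qed.

Lemma partial_subc F (k : R) i : partial i (fun v => F v - k) = partial i F.
Proof.
apply/funext => v; apply: (congr1 (fun q : R -> R => lim (q h @[h --> 0^']))).
by apply/funext => h /=; congr (_ *: _); ring.
Qed.

Lemma laplacian_subc F (k : R) v : laplacian (fun v => F v - k) v = laplacian F v.
Proof. by rewrite /laplacian; apply: eq_bigr => i _; rewrite partial_subc. Qed.

Lemma C2_at_subc F (k : R) p : C2_at F p -> C2_at (fun v => F v - k) p.
Proof.
move=> F2 i; have [Fn Fp] := F2 i; split; last by rewrite partial_subc.
apply: filterS Fn => t.
suff -> : derivable (fun v => F v - k) (line p i t) (basis_vec R i) =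
    derivable F (line p i t) (basis_vec R i) by [].
apply: (congr1 (fun q : R -> R => cvg (q h @[h --> 0^']))).
by apply/funext => h /=; congr (_ *: _); ring.
Qed.

End smooth_functions.

Section supersolution.
Context {R : realType} {n : nat}.
Implicit Types (v w x : 'rV[R]_n).
Context (f g : 'rV[R]_n -> R).
Hypotheses (f0 : forall v, 0 <= f v) (cf : continuous f)
  (f2 : forall v, C2_at f v) (f_super : forall v, laplacian f v <= g v * f v).

(** Near [x] the bound is continuity. Farther out, the Lipschitz bound on [g] gives [g <= G] on a
    large ball, and a steep enough Gaussian barrier lies below [f] on the annulus. *)
Lemma supersolution_lower_bound (m : R) x (r : R) : (forall v, 0 <= g v) ->
  (forall v w, g v <= g w + enorm (v - w) * m) -> 0 <= m ->
  0 < f x -> 0 <= r ->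
  exists2 delta, 0 < delta & forall v, enorm (v - x) <= r -> delta <= f v.
Proof.
move=> g0 gm m0 fx r0.
pose eta := f x / 2.
have eta0 : 0 < eta by rewrite divr_gt0.
have [rho rho0 Hrho] : exists2 rho, 0 < rho & forall v, enorm (v - x) <= rho -> eta <= f v.
  have cfx : {for x, continuous f} by exact: cf.
  have : \forall v \near x, eta < f v by apply: (cvgr_gt _ cfx); rewrite /eta; lra.
  move=> /nbhs_ballP[d /= d0 Hd]; exists (d / 2); first by rewrite divr_gt0.
  move=> v vd; apply/ltW/Hd; split => // i j.
  rewrite ord1 /ball/= distrC.
  by have := coord_le_enorm (v - x) j; rewrite !mxE; lra.
(* Larger than both [r] and [rho], so that the barrier is still positive at distance [r]. *)
pose r2 := r + rho + 1.
pose G := g x + r2 * m.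
have r20 : 0 <= r2 by rewrite /r2; lra.
have G0 : 0 <= G by rewrite addr_ge0// mulr_ge0.
have n0 : 0 <= n%:R :> R by [].
(* Chosen so that [l * (4 * rho ^+ 2) - 2 * n%:R] is at least [G + 1]; multiplying by [l >= 1] gives
   [lG]. *)
pose l := 1 + (2 * n%:R + G + 1) / (4 * rho ^+ 2).
have rr : 0 < 4 * rho ^+ 2 by rewrite mulr_gt0// exprn_gt0.
have l1 : 1 <= l by rewrite lerDl divr_ge0 ?(ltW rr)//; lra.
have lG : G < 4 * l ^+ 2 * rho ^+ 2 - 2 * l * n%:R.
  have ls : l * (4 * rho ^+ 2) = 4 * rho ^+ 2 + (2 * n%:R + G + 1).
    by rewrite /l; field; rewrite gt_eqF.
  apply: (@lt_le_trans _ _ (l * (G + 1))).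
    by apply: (@lt_le_trans _ _ (G + 1)); [lra|rewrite ler_peMl//; lra].
  rewrite [leRHS](_ : _ = l * (l * (4 * rho ^+ 2) - 2 * n%:R)); last by ring.
  by rewrite ler_wpM2l//; lra.
(* [l] is large enough for [phi] to be a strict subsolution on the annulus. *)
pose phi := gaussian_barrier x l (expR (- (l * r2 ^+ 2))).
have phi_le v : phi v <= expR (- (l * enorm (v - x) ^+ 2)).
  by rewrite /phi /gaussian_barrier lerBlDr lerDl expR_ge0.
have E1 v : expR (- (l * enorm (v - x) ^+ 2)) <= 1.
  by rewrite -expR0 ler_expR oppr_le0 mulr_ge0 ?sqr_ge0//; lra.
have cmp : forall v, rho <= enorm (v - x) <= r2 -> eta * phi v <= f v.
  apply: annulus_comparison => //.
  - exact: continuous_gaussian_barrier.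
  - by move=> v _; split => //; exact: C2_gaussian_barrier.
  (* With [E] the Gaussian at [v], where [f < eta * phi] one has [g * f <= G * (eta * E)], which
     [lG] places strictly below [eta] times the Laplacian of [phi]. *)
  - move=> v /andP[v1 v2] fphi; rewrite laplacian_gaussian_barrier.
    apply: le_lt_trans (f_super v) _.
    set E := expR _.
    have EE : 0 < E by exact: expR_gt0.
    have gG : g v <= G.
      by apply: le_trans (gm v x) _; rewrite lerD2l ler_wpM2r// ltW.
    have fE : f v <= eta * E.
      by apply: le_trans (ltW fphi) _; rewrite ler_pM2l// phi_le.
    apply: (@le_lt_trans _ _ (G * (eta * E))); first by rewrite ler_pM.
    rewrite mulrCA ltr_pM2l// mulrC ltr_pM2l//; apply: lt_le_trans lG _.
    rewrite lerD2r ler_wpM2l//; first by rewrite mulr_ge0 ?sqr_ge0.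
    by rewrite ler_pXn2r// ?nnegrE ?ltW// (lt_trans rho0).
  (* On the inner sphere [phi <= 1] and [f >= eta]; on the outer one [phi = 0]. *)
  - move=> v [v1|v2].
      apply: le_trans (Hrho v _); last by rewrite v1.
      by rewrite ler_piMr//; [exact: ltW|exact: le_trans (phi_le v) (E1 v)].
    by rewrite /phi /gaussian_barrier v2 subrr mulr0.
(* The value of [eta * phi] at distance [r], its least value up to that distance because [phi]
   decreases radially. *)
pose delta2 := eta * (expR (- (l * r ^+ 2)) - expR (- (l * r2 ^+ 2))).
have d20 : 0 < delta2.
  rewrite mulr_gt0// subr_gt0 ltr_expR ltrN2 ltr_pM2l; last by lra.
  by rewrite ltr_pXn2r// ?nnegrE// /r2; lra.
exists (Num.min eta delta2); first by rewrite lt_min eta0 d20.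
move=> v vr; rewrite ge_min; have [/Hrho->//|rv] := leP (enorm (v - x)) rho.
apply/orP; right; apply: le_trans (cmp v _); last first.
  by rewrite ltW//= (le_trans vr)// /r2; lra.
rewrite ler_pM2l// lerD2r ler_expR lerN2 ler_wpM2l//; first by lra.
by rewrite ler_pXn2r// ?nnegrE// enorm_ge0.
Qed.

(* Compare with [K (h - t)], nonpositive on a large sphere, and let [t] tend to 0. *)
Lemma supersolution_ge_exp (r a K : R) : 0 < r -> 0 < a -> 0 < K ->
  let h := fun v : 'rV[R]_n => expR (- (a * enorm v `^ (3 / 2))) in
  (forall v, 0 < g v) ->
  (forall v, r < enorm v -> 0 <= laplacian h v - g v * h v) ->
  (forall v, enorm v <= r -> K <= f v) ->
  forall v, K * h v <= f v.
Proof.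
move=> r0 a0 K0 h g0 hh Kf v.
have h1 w : h w <= 1.
  by rewrite -expR0 ler_expR oppr_le0 mulr_ge0 ?powR_ge0// ltW.
have Kh w : enorm w <= r -> K * h w <= f w.
  by move=> wr; rewrite (le_trans _ (Kf w wr))// ler_piMr// ltW.
have [/Kh//|rv] := leP (enorm v) r.
apply/ler_addgt0Pr => e e0.
(* Lowering [h] by [t] costs exactly [K * t = e]. *)
pose t := e / K; have t0 : 0 < t by rewrite divr_gt0.
(* [M] exceeds [enorm v], so the annulus contains [v]. Also [M >= 1] gives [M <= M^(3/2)], and
   [a * M >= t^-1]; since [expR y >= 1 + y], this yields [h <= t] on the outer sphere. *)
pose M := enorm v + 1 + (a * t)^-1.
have at0 : 0 < (a * t)^-1 by rewrite invr_gt0 mulr_gt0.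
have vM : enorm v < M by rewrite /M; lra.
have hM w : enorm w = M -> h w <= t.
  move=> wM; rewrite /h wM expRN invf_ple ?posrE ?expR_gt0//.
  have M1 : 1 <= M by have := enorm_ge0 v; rewrite /M; lra.
  apply: (@le_trans _ _ (a * M)).
    rewrite -[leLHS](mulVKf (lt0r_neq0 a0)) -invfM ler_pM2l// /M.
    by have := enorm_ge0 v; lra.
  have MM : M <= M `^ (3 / 2).
    rewrite -[leLHS]powRr1; last by lra.
    by rewrite ler_powR//; lra.
  apply: le_trans (expR_ge1Dx _).
  have : a * M <= a * M `^ (3 / 2) by rewrite ler_pM2l.
  lra.
have := @annulus_comparison R n f (fun w => h w - t) K 0 r M cf _ _ _ _ v.
rewrite subr0 => H.
have : K * (h v - t) <= f v.
  apply: H; last by rewrite !ltW.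
  - move=> w; apply: (@continuousB _ _ _ h (cst t)); last exact: cst_continuous.
    exact: continuous_exp_powR.
  - move=> w; rewrite subr0 => /andP[rw _]; split => //.
    by apply/C2_at_subc/C2_exp_powR/(lt_trans r0).
  - move=> w; rewrite subr0 laplacian_subc => /andP[rw _] fw.
    apply: le_lt_trans (f_super w) _.
    (* Strictness comes from [g w > 0] together with [f w < K * (h w - t)]. *)
    apply: (@lt_le_trans _ _ (g w * (K * h w))).
      rewrite ltr_pM2l// (lt_le_trans fw)// ler_pM2l//; lra.
    by rewrite mulrCA ler_pM2l// -subr_ge0 hh.
  - move=> w; rewrite subr0 => -[wr|wM].
      apply: le_trans (Kh w _); last by rewrite wr.
      by rewrite ler_pM2l//; lra.
    apply: le_trans (f0 w); rewrite pmulr_rle0// subr_le0; exact: hM.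
rewrite mulrBr /t mulrCA divff ?gt_eqF// mulr1; lra.
Qed.

End supersolution.

(** * The exponential lower bound for the steady state *)

Theorem lemma7p2 (R : realType) (N : nat) (hN : (2 <= N)%N)
  (alpha c : R) (halpha : 0 < alpha < 1) (hc : kernel_normalized N c)
  (f Q : 'rV[R]_N -> R)
  (f_ge0 : forall v, 0 <= f v)
  (f_smooth : smooth f)
  (f_L11 : L11 f)
  (hQ : is_collision alpha c f Q)
  (f_sol : forall v, laplacian f v + Q v = 0)
  (f_mass : (0 < \int[lebesgue_rV R N]_v (f v)%:E)%E)
  (r a : R) (hr : 0 < r) (ha : 0 < a)
  (hh : let h := fun v : 'rV[R]_N => expR (- (a * enorm v `^ (3 / 2))) in
        forall v, r < enorm v -> 0 <= laplacian h v - conv_norm f v * h v) :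
  exists K : R, 0 < K /\
    forall v, K * expR (- (2 * a * enorm v `^ (3 / 2))) <= f v.
Proof.
pose g := conv_norm f.
have cf := smooth_continuous f_smooth.
have f_C2 v := smooth_C2_at v f_smooth.
have cQ : continuous Q.
  rewrite (_ : Q = fun v => - laplacian f v); last first.
    by apply/funext => v; apply/eqP; rewrite -addr_eq0 addrC f_sol.
  move=> v; apply: (@continuousN _ _ _ (laplacian f)).
  exact: smooth_continuous_laplacian.
have f_super v : laplacian f v <= g v * f v.
  have := collision_ge_loss hc f_ge0 f_L11 cf cQ hQ v.
  have := f_sol v; rewrite /g; lra.
have g0 v : 0 <= g v by exact: conv_norm_ge0.
have [x fx] : exists x, 0 < f x.
  apply: contrapT => fle.
  move: f_mass; rewrite integral0_eq ?ltxx// => v _.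
  congr EFin; apply/eqP; rewrite eq_le f_ge0 andbT leNgt; apply/negP => fv.
  by apply: fle; exists v.
have lower := supersolution_lower_bound f_ge0 cf f_C2 f_super g0
  (conv_norm_le f_ge0 f_L11) (Rintegral_ge0 _ (fun w _ => f_ge0 w)) fx.
have f_gt0 v : 0 < f v.
  have [d d0 H] := lower _ (enorm_ge0 (v - x)).
  by apply: lt_le_trans (H v _).
have g_gt0 v : 0 < g v.
  pose i : 'I_N := Ordinal (ltnW hN).
  (* A point at distance [1] from [v], where [f] is positive, contributes to the integral. *)
  apply: (@conv_norm_gt0 _ _ f f_ge0 f_L11 v (v - basis_vec R i)); [exact: cf|exact: f_gt0|].
  by rewrite opprB addrC subrK /enorm dot_basis sqrtr1.
(* The ball of this radius about [x] contains the ball of radius [r] about the origin. *)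
have [K K0 HK] := lower (r + enorm x) (addr_ge0 (ltW hr) (enorm_ge0 x)).
exists K; split => // v.
apply: (@le_trans _ _ (K * expR (- (a * enorm v `^ (3 / 2))))).
  rewrite ler_pM2l// ler_expR lerN2 -mulrA ler_peMl ?mulr_ge0 ?powR_ge0//; lra.
apply: (supersolution_ge_exp f_ge0 cf f_C2 f_super hr ha K0 g_gt0 hh) => w wr.
apply: HK; apply: le_trans (enormD w (- x)) _.
by rewrite enormN lerD2r.
Qed.
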